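(* Let $a$ and $n$ be positive integers, let $S=\{x_1,\dots,x_n\}$ be a factor closed set of $n$ distinct positive integers indexed so that $x_1=1$, and let $f$ be an arithmetic function. Let $B=(b_{ij})$ be the $n\times n$ matrix with $b_{ij}=\mu\left(\frac{x_j}{x_i}\right)$ if $x_i\mid x_j$ and $b_{ij}=0$ otherwise, and let $B_{f^a}$ be the $n\times n$ matrix whose $(i,j)$-entry is $\mu\left(\frac{x_j}{x_i}\right)f\left(\frac{x_j}{x_i}\right)^a$ if $x_i\mid x_j$ and $0$ otherwise. (i) If $f$ is multiplicative, then $$B^T\big(f^a((x_i,x_j))\big)B=\operatorname{diag}\Big(1,\ \prod_{p\mid x_2}\big(f^a(p^{\nu_p(x_2)})-f^a(p^{\nu_p(x_2)-1})\big),\ \dots,\ \prod_{p\mid x_n}\big(f^a(p^{\nu_p(x_n)})-f^a(p^{\nu_p(x_n)-1})\big)\Big).$$ (ii) If $f$ is completely multiplicative, then $$B^T\big(f^a((x_i,x_j))\big)B=\operatorname{diag}\Big(1,\ \prod_{p\mid x_2}\big(f(p)^{a\nu_p(x_2)}-f(p)^{a(\nu_p(x_2)-1)}\big),\ \dots,\ \prod_{p\mid x_n}\big(f(p)^{a\nu_p(x_n)}-f(p)^{a(\nu_p(x_n)-1)}\big)\Big),$$ and moreover $$B_{f^a}^T\big(f^a([x_i,x_j])\big)B_{f^a}=\operatorname{diag}\Big(1,\ \prod_{p\mid x_2}\big(f(p)^{a\nu_p(x_2)}-f(p)^{a(\nu_p(x_2)+1)}\big),\ \dots,\ \prod_{p\mid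 x_n}\big(f(p)^{a\nu_p(x_n)}-f(p)^{a(\nu_p(x_n)+1)}\big)\Big).$$ All products run over the primes $p$ dividing the indicated integer.
   Context: $(x,y)$ denotes the greatest common divisor and $[x,y]$ the least common multiple. $f^a(x)$ means $f(x)^a$ (with $0^0=1$); $(f^a((x_i,x_j)))$ and $(f^a([x_i,x_j]))$ denote the $n\times n$ matrices with $(i,j)$-entries $f((x_i,x_j))^a$ and $f([x_i,x_j])^a$. A set $S$ of positive integers is factor closed if every positive divisor of every element of $S$ lies in $S$. $\mu$ is the Möbius function and $\nu_p(x)$ the $p$-adic valuation. An arithmetic function (complex-valued function on the positive integers) $f$ is multiplicative if $f(1)=1$ and $f(xy)=f(x)f(y)$ for coprime $x,y$; completely multiplicative if $f(1)=1$ and $f(xy)=f(x)f(y)$ for all $x,y$. *)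

(* Defs.v *)
From mathcomp Require Import all_boot all_order all_algebra.
From mathcomp Require Import complex reals.

Set Implicit Arguments.
Unset Strict Implicit.
Unset Printing Implicit Defensive.

Local Open Scope ring_scope.

(* primes m is duplicate-free, so its size is the number of distinct primes
   dividing m. The value mobius 0 = 1 is junk. *)
Definition mobius (m : nat) : int :=
  if all (fun p => logn p m == 1%N) (primes m)
  then (-1) ^+ size (primes m) else 0.

(* Arithmetic functions are total on nat; neither predicate constrains f 0. *)
Definition multiplicative_arith (C : pzRingType) (f : nat -> C) : Prop :=
  f 1%N = 1 /\
  forall x y : nat, (0 < x)%N -> (0 < y)%N -> coprime x y ->
    f (x * y)%N = f x * f y.

Definition completely_multiplicative_arith (C : pzRingType) (f : nat -> C) : Prop :=
  f 1%N = 1 /\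
  forall x y : nat, (0 < x)%N -> (0 < y)%N -> f (x * y)%N = f x * f y.

(* When S consists of positive integers, a divisor d of x \in S is positive. *)
Definition factor_closed (S : seq nat) : Prop :=
  forall x d : nat, x \in S -> (d %| x)%N -> d \in S.

Section Matrices.

Variables (C : pzRingType) (n : nat) (x : 'I_n -> nat).

Definition gcd_mx (g : nat -> C) : 'M[C]_n :=
  \matrix_(i, j) g (gcdn (x i) (x j)).

Definition lcm_mx (g : nat -> C) : 'M[C]_n :=
  \matrix_(i, j) g (lcmn (x i) (x j)).

Definition mobius_mx : 'M[C]_n :=
  \matrix_(i, j)
    if (x i %| x j)%N then (mobius (x j %/ x i))%:~R else 0.

Definition twisted_mobius_mx (g : nat -> C) : 'M[C]_n :=
  \matrix_(i, j)
    if (x i %| x j)%N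
    then (mobius (x j %/ x i))%:~R * g (x j %/ x i)%N else 0.

(* diag(1, F x_2, ..., F x_n), the first index being 0 in 'I_n. *)
Definition diag1_mx (F : nat -> C) : 'M[C]_n :=
  diag_mx (\row_j if val j == 0%N then 1 else F (x j)).

End Matrices.

(* Main.v *)
(** Let Z_g have entries g (x_j / x_i) when x_i divides x_j and 0 otherwise.
    Since S is factor closed, Moebius inversion says that the twisted Moebius
    matrix of a completely multiplicative g is the inverse of Z_g.  Hence it
    suffices to factor the gcd matrix as Z_1^T D Z_1 and the lcm matrix as
    Z_g^T D Z_g with D diagonal.  Entrywise these factorizations are the
    convolution identities  sum_(d | m) H d = g m  and
    sum_(d | m) H d * g (m / d) ^ 2 = g m;  all the functions involved are
    multiplicative, so the identities are checked on prime powers, where the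
    sums telescope.  No inverse of g is needed for the lcm matrix: with
    c = (u, v),  [u, v] = c (u / c) (v / c)  and g (c) is expanded. *)

Require Import Defs.
From mathcomp Require Import all_boot all_order all_algebra.
From mathcomp Require Import complex reals.
From mathcomp Require Import ring.

Set Implicit Arguments.
Unset Strict Implicit.
Unset Printing Implicit Defensive.

Local Open Scope ring_scope.
Local Open Scope complex_scope.

Import GRing.Theory.

(** * Primes and divisors of a product of coprime numbers *)

Lemma primesM_coprime (m n : nat) : (0 < m)%N -> (0 < n)%N -> coprime m n ->
  perm_eq (primes (m * n)) (primes m ++ primes n).
Proof.
move=> m_gt0 n_gt0 co_mn; apply: uniq_perm => [||p]; first exact: primes_uniq.
  by rewrite cat_uniq !primes_uniq -coprime_has_primes // co_mn.
by rewrite mem_cat primesM.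
Qed.

Lemma logn_mul_coprime (m n p : nat) : coprime m n -> p \in primes m ->
  logn p (m * n) = logn p m.
Proof.
move=> co_mn; rewrite mem_primes => /and3P[_ _ dvp].
by rewrite mulnC logn_Gauss // (coprime_dvdl dvp).
Qed.

(** By coprimality [d] and [e] are recovered from [d * e] as its gcds with [m] and [n], so the
    products are pairwise distinct. *)
Lemma divisorsM_coprime (m n : nat) : (0 < m)%N -> (0 < n)%N -> coprime m n ->
  perm_eq (divisors (m * n))
    [seq (d * e)%N | d <- divisors m, e <- divisors n].
Proof.
move=> m_gt0 n_gt0 co_mn; apply: uniq_perm => [||k].
- exact: divisors_uniq.
- apply: allpairs_uniq; try exact: divisors_uniq.
  move=> u v /allpairsP[[d e] /= [dm en ->]] /allpairsP[[d' e'] /= [dm' en' ->]] /=.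
  rewrite -!dvdn_divisors // in dm en dm' en'.
  have gcd_m a b : (a %| m)%N -> (b %| n)%N -> gcdn m (a * b) = a.
    move=> am bn; rewrite Gauss_gcdl ?(coprime_dvdr bn) //.
    exact/gcdn_idPr.
  have gcd_n a b : (a %| m)%N -> (b %| n)%N -> gcdn n (a * b) = b.
    move=> am bn; rewrite Gauss_gcdr; first exact/gcdn_idPr.
    by rewrite coprime_sym (coprime_dvdl am).
  move=> eq_de; congr (_, _).
    by rewrite -(gcd_m d e) // eq_de gcd_m.
  by rewrite -(gcd_n d e) // eq_de gcd_n.
- rewrite -dvdn_divisors ?muln_gt0 ?m_gt0 //.
  apply/idP/allpairsP => [k_mn|[[d e] /= []]]; last first.
    by rewrite -!dvdn_divisors // => dm en ->; rewrite dvdn_mul.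
  (* With [g = gcdn k m], the quotient [k / g] divides [(m / g) * n] and is coprime to [m / g],
     hence divides [n]. *)
  exists (gcdn k m, (k %/ gcdn k m)%N) => /=.
  rewrite -!dvdn_divisors // dvdn_gcdr mulnC divnK ?dvdn_gcdl //.
  have g_gt0 : (0 < gcdn k m)%N by rewrite gcdn_gt0 m_gt0 orbT.
  split=> //; rewrite -(@Gauss_dvdr _ (m %/ gcdn k m)).
    rewrite -(dvdn_pmul2l g_gt0) mulnA [X in (_ %| X * _)%N]mulnC.
    by rewrite [X in (X %| _)%N]mulnC !divnK ?dvdn_gcdl ?dvdn_gcdr.
  rewrite /coprime -(eqn_pmul2l g_gt0) muln1 muln_gcdr.
  by rewrite ![(gcdn k m * _)%N]mulnC !divnK ?dvdn_gcdl ?dvdn_gcdr // gcdnC.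
Qed.

Lemma lcmn_gcdnE (m n : nat) :
  lcmn m n = (gcdn m n * ((m %/ gcdn m n) * (n %/ gcdn m n)))%N.
Proof.
rewrite mulnA (mulnC (gcdn m n)) divnK ?dvdn_gcdl //.
by rewrite muln_divA ?dvdn_gcdr.
Qed.

(** * Dirichlet convolution and Euler products *)

Section ArithmeticFunctions.

Variable C : comPzRingType.
Implicit Types F G K g : nat -> C.

(** Strong induction: splitting off the full power of the least prime factor leaves a strictly
    smaller coprime cofactor. *)
Lemma multiplicative_ext F G :
  multiplicative_arith F -> multiplicative_arith G ->
  (forall p k, prime p -> F (p ^ k.+1)%N = G (p ^ k.+1)%N) ->
  forall m, (0 < m)%N -> F m = G m.
Proof.
move=> [F1 FM] [G1 GM] eqFG; elim/ltn_ind=> m IHm m_gt0.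
have [m_le1|m_gt1] := leqP m 1.
  by have/eqP-> : m == 1%N; rewrite ?F1 ?G1 // eqn_leq m_le1.
have p_pr := pdiv_prime m_gt1; set p := pdiv m in p_pr.
have [q co_pq m_eq] := pfactor_coprime p_pr m_gt0.
have : (0 < logn p m)%N by rewrite logn_gt0 pi_pdiv.
case: (logn p m) m_eq => // k m_eq _; have [q_gt0 pk_gt0] : (0 < q)%N /\ (0 < p ^ k.+1)%N.
  by apply/andP; rewrite -muln_gt0 -m_eq.
have co_qp : coprime q (p ^ k.+1) by rewrite coprime_sym coprimeXl.
rewrite m_eq FM // GM // eqFG // IHm // m_eq.
by rewrite ltn_Pmulr // -(exp1n k.+1) ltn_exp2r // prime_gt1.
Qed.

Definition dirichlet F K (m : nat) : C :=
  \sum_(d <- divisors m) F d * K (m %/ d)%N.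

Lemma dirichlet_multiplicative F K :
  multiplicative_arith F -> multiplicative_arith K ->
  multiplicative_arith (dirichlet F K).
Proof.
move=> [F1 FM] [K1 KM]; split=> [|m n m_gt0 n_gt0 co_mn].
  by rewrite /dirichlet big_seq1 F1 K1 mulr1.
rewrite /dirichlet (perm_big _ (divisorsM_coprime m_gt0 n_gt0 co_mn)) /=.
rewrite big_allpairs_dep mulr_suml !big_seq; apply: eq_bigr => d.
rewrite -dvdn_divisors // => dm; rewrite mulr_sumr !big_seq.
apply: eq_bigr => e; rewrite -dvdn_divisors // => en.
have d_gt0 := dvdn_gt0 m_gt0 dm; have e_gt0 := dvdn_gt0 n_gt0 en.
have md_gt0 : (0 < m %/ d)%N by rewrite divn_gt0 // dvdn_leq.
have ne_gt0 : (0 < n %/ e)%N by rewrite divn_gt0 // dvdn_leq.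
have -> : (m * n %/ (d * e) = (m %/ d) * (n %/ e))%N.
  by rewrite -{1}(divnK dm) -{1}(divnK en) mulnACA mulnK // muln_gt0 d_gt0.
rewrite FM ?KM ?(coprime_dvdl dm) ?(coprime_dvdr en) //; first by ring.
apply: coprime_dvdl (dvdn_div dm) _; exact: coprime_dvdr (dvdn_div en) _.
Qed.

Lemma dirichlet_pfactor F K p k : prime p ->
  dirichlet F K (p ^ k)%N = \sum_(i < k.+1) F (p ^ i)%N * K (p ^ (k - i))%N.
Proof.
move=> p_pr; have p_gt0 := prime_gt0 p_pr.
have -> : dirichlet F K (p ^ k)%N =
    \sum_(d <- [seq (p ^ i)%N | i <- iota 0 k.+1]) F d * K (p ^ k %/ d)%N.
  apply: perm_big; apply: uniq_perm => [||d]; first exact: divisors_uniq.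
    by rewrite map_inj_uniq ?iota_uniq //; apply: expnI; apply: prime_gt1.
  rewrite -dvdn_divisors ?expn_gt0 ?p_gt0 //.
  apply/dvdn_pfactor/mapP => // -[i le_ik ->]; exists i => //.
    by rewrite mem_iota.
  by move: le_ik; rewrite mem_iota.
rewrite big_map -[iota _ _]/(index_iota 0 k.+1) big_mkord; apply: eq_bigr => i _.
by rewrite expnB // -ltnS.
Qed.

(** The multiplicative function with prescribed value [h p v] at [p ^ v]; only exponents [v >= 1]
    are ever consulted. *)
Definition euler_prod (h : nat -> nat -> C) (m : nat) : C :=
  \prod_(p <- primes m) h p (logn p m).

Lemma euler_prod_multiplicative h : multiplicative_arith (euler_prod h).
Proof.
split=> [|m n m_gt0 n_gt0 co_mn]; first by rewrite /euler_prod big_nil.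
rewrite /euler_prod (perm_big _ (primesM_coprime m_gt0 n_gt0 co_mn)) big_cat /=.
congr (_ * _); rewrite !big_seq; apply: eq_bigr => p p_in.
  by rewrite logn_mul_coprime.
by rewrite mulnC logn_mul_coprime // coprime_sym.
Qed.

Lemma euler_prod_pfactor h p k : prime p ->
  euler_prod h (p ^ k.+1) = h p k.+1.
Proof.
by move=> p_pr; rewrite /euler_prod primesX // primes_prime // big_seq1 pfactorK.
Qed.

Lemma mobius_euler_prod (m : nat) :
  (mobius m)%:~R = euler_prod (fun _ v => if v == 1%N then - 1 else 0) m.
Proof.
(* The induction is on an arbitrary list in place of [primes m], while [m] stays fixed inside
   [logn]. *)
rewrite /mobius /euler_prod; elim: (primes m) => [|p s IHs] /=.
  by rewrite big_nil.
rewrite big_cons -IHs; case: eqP => _ /=; last by rewrite mul0r.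
by case: ifP => _; rewrite ?mulr0 // exprS intrM rmorphN.
Qed.

Lemma mobius_multiplicative : multiplicative_arith (fun m => (mobius m)%:~R : C).
Proof.
have [E1 EM] :=
  euler_prod_multiplicative (fun _ v => if v == 1%N then - 1 else 0).
by split=> [|m n *]; rewrite !mobius_euler_prod ?EM.
Qed.

Lemma one_multiplicative : multiplicative_arith (fun _ => 1 : C).
Proof. by split=> // *; rewrite mulr1. Qed.

Lemma completely_multiplicative_multiplicative g :
  completely_multiplicative_arith g -> multiplicative_arith g.
Proof. by case=> g1 gM; split=> // *; apply: gM. Qed.

Lemma completely_multiplicativeX g p k : (0 < p)%N ->
  completely_multiplicative_arith g -> g (p ^ k)%N = g p ^+ k.
Proof.
move=> p_gt0 [g1 gM]; elim: k => [|k IHk]; first by rewrite expn0 g1.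
by rewrite expnS gM ?expn_gt0 ?p_gt0 // IHk exprS.
Qed.

Lemma multiplicative_exp F a :
  multiplicative_arith F -> multiplicative_arith (fun m => F m ^+ a).
Proof.
by case=> F1 FM; split=> [|m n *]; rewrite ?F1 ?expr1n // FM // exprMn.
Qed.

Lemma completely_multiplicative_exp g a :
  completely_multiplicative_arith g ->
  completely_multiplicative_arith (fun m => g m ^+ a).
Proof.
by case=> g1 gM; split=> [|m n *]; rewrite ?g1 ?expr1n // gM // exprMn.
Qed.

(** At [p ^ k.+1] only the divisors 1 and [p] contribute, giving 1 - 1 = 0. *)
Lemma sum_mobius m : (0 < m)%N ->
  \sum_(d <- divisors m) (mobius d)%:~R = (m == 1%N)%:R :> C.
Proof.
move=> m_gt0.
have delta_mult : multiplicative_arith (fun m => (m == 1%N)%:R : C).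
  by split=> // u v *; rewrite muln_eq1 -natrM mulnb.
transitivity (dirichlet (fun m => (mobius m)%:~R) (fun=> 1) m).
  by apply: eq_bigr => d _; rewrite mulr1.
apply: (multiplicative_ext _ delta_mult) m_gt0 => [|p k p_pr].
  exact: dirichlet_multiplicative mobius_multiplicative one_multiplicative.
rewrite dirichlet_pfactor // !big_ord_recl big1 => [|i _].
  rewrite !mulr1 !addr0 (mobius_multiplicative).1 mobius_euler_prod.
  rewrite euler_prod_pfactor // subrr expnS muln_eq1.
  by case: eqP p_pr => // ->.
by rewrite mulr1 mobius_euler_prod euler_prod_pfactor.
Qed.

(** * Diagonal entries and their convolution identities *)

(** A generalized Euler totient, which is the case where [g] is the identity. The truncated
    subtraction is harmless, since [logn p m >= 1] for [p] in [primes m]. *)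
Definition gcd_factor g (m : nat) : C :=
  \prod_(p <- primes m) (g (p ^ logn p m)%N - g (p ^ (logn p m - 1))%N).

Lemma gcd_factor_euler_prod g :
  gcd_factor g = euler_prod (fun p v => g (p ^ v)%N - g (p ^ (v - 1))%N).
Proof. by []. Qed.

Lemma sum_gcd_factor g m : multiplicative_arith g -> (0 < m)%N ->
  \sum_(d <- divisors m) gcd_factor g d = g m.
Proof.
move=> g_mult m_gt0; transitivity (dirichlet (gcd_factor g) (fun=> 1) m).
  by apply: eq_bigr => d _; rewrite mulr1.
have h_mult : multiplicative_arith (gcd_factor g).
  rewrite gcd_factor_euler_prod; exact: euler_prod_multiplicative.
apply: (multiplicative_ext _ g_mult) m_gt0 => [|p k p_pr].
  exact: dirichlet_multiplicative h_mult one_multiplicative.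
(* The sum over powers of [p] telescopes; the induction starts at exponent 0. *)
rewrite dirichlet_pfactor //; elim: k.+1 => [|v IHv].
  by rewrite big_ord1 mulr1 h_mult.1 g_mult.1.
rewrite big_ord_recr /= IHv mulr1 gcd_factor_euler_prod euler_prod_pfactor //.
by rewrite subn1 addrC subrK.
Qed.

Definition lcm_factor g (m : nat) : C :=
  \prod_(p <- primes m) (g p ^+ logn p m - g p ^+ (logn p m + 1)).

Lemma lcm_factor_euler_prod g :
  lcm_factor g = euler_prod (fun p v => g p ^+ v - g p ^+ (v + 1)).
Proof. by []. Qed.

(** Let S(v) be the sum at [p ^ v]. Raising the exponent by one multiplies every old term by
    [g p ^+ 2] and adds one new term, so S(v+1) = g(p)^2 S(v) + g(p)^(v+1) - g(p)^(v+2), and S(v) =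
    g(p)^v follows by induction. *)
Lemma sum_lcm_factor g m : completely_multiplicative_arith g -> (0 < m)%N ->
  \sum_(d <- divisors m) lcm_factor g d * g (m %/ d)%N ^+ 2 = g m.
Proof.
move=> g_cm m_gt0; have g_mult := completely_multiplicative_multiplicative g_cm.
have h_mult : multiplicative_arith (lcm_factor g).
  rewrite lcm_factor_euler_prod; exact: euler_prod_multiplicative.
apply: (@multiplicative_ext (dirichlet (lcm_factor g) (fun d => g d ^+ 2)))
  m_gt0 => // [|p k p_pr].
  exact: dirichlet_multiplicative h_mult (multiplicative_exp 2 g_mult).
have p_gt0 := prime_gt0 p_pr.
rewrite dirichlet_pfactor //; elim: k.+1 => [|v IHv].
  by rewrite big_ord1 h_mult.1 g_mult.1 expr1n mulr1.
rewrite big_ord_recr /= subnn expn0 g_mult.1 expr1n mulr1.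
rewrite lcm_factor_euler_prod euler_prod_pfactor //.
under eq_bigr => i _.
  rewrite subSn -1?ltnS // expnS (g_cm.2 p) ?expn_gt0 ?p_gt0 // exprMn mulrCA.
  over.
rewrite -mulr_sumr IHv !completely_multiplicativeX // addn1 !exprS; ring.
Qed.

End ArithmeticFunctions.

(** * Matrices indexed by a factor closed set *)

Section FactorClosed.

Variables (C : comPzRingType) (n : nat) (x : 'I_n -> nat).
Hypotheses (x_gt0 : forall i, (0 < x i)%N) (x_inj : injective x).
Hypothesis x_fc : factor_closed (codom x).

(** Turns the index sums of matrix products into divisor sums: [x] maps the indices [k] with [x k]
    dividing [m] bijectively onto the divisors of [m]. *)
Lemma sum_factor_closed (F : nat -> C) m : (0 < m)%N ->
    (forall d, (d %| m)%N -> d \in codom x) ->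
  \sum_(k | (x k %| m)%N) F (x k) = \sum_(d <- divisors m) F d.
Proof.
move=> m_gt0 m_fc; have /(perm_big _)-> /= :
    perm_eq (divisors m) [seq x k | k <- enum [pred k | (x k %| m)%N]].
  apply: uniq_perm => [||d]; first exact: divisors_uniq.
    by rewrite map_inj_uniq ?enum_uniq.
  rewrite -dvdn_divisors //; apply/idP/mapP => [dm|[k]].
    by have /codomP[k dE] := m_fc d dm; exists k; rewrite // mem_enum inE -dE.
  by rewrite mem_enum inE => xkm ->.
by rewrite big_map big_enum.
Qed.

Definition zeta_mx (g : nat -> C) : 'M[C]_n :=
  \matrix_(i, j) if (x i %| x j)%N then g (x j %/ x i)%N else 0.

Lemma twisted_mobius_mxK (g : nat -> C) : completely_multiplicative_arith g ->
  zeta_mx g *m twisted_mobius_mx x g = 1%:M.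
Proof.
(* For square matrices a one-sided inverse is two-sided. In the swapped order the Moebius factor is
   [mobius (x k %/ x i)], so putting [x k = x i * e] yields a plain sum of [mobius e]. *)
move=> [g1 gM]; apply: mulmx1C; apply/matrixP => i j; rewrite !mxE.
have [xij|xij] := boolP (x i %| x j)%N; last first.
  rewrite big1 => [|k _]; first by case: eqP xij => // ->; rewrite dvdnn.
  rewrite !mxE; case: ifP => xik; last by rewrite mul0r.
  case: ifP => xkj; last by rewrite mulr0.
  by rewrite (dvdn_trans xik xkj) in xij.
set m := (x j %/ x i)%N; have xjE : x j = (x i * m)%N by rewrite mulnC divnK.
have m_gt0 : (0 < m)%N by rewrite divn_gt0 // dvdn_leq.
(* Complete multiplicativity merges [g (x k %/ x i)] and [g (x j %/ x k)] into the constant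
   [g m]. *)
pose G d := if (x i %| d)%N then (mobius (d %/ x i))%:~R * g m else 0 : C.
transitivity (\sum_(k | (x k %| x j)%N) G (x k)).
  rewrite [RHS]big_mkcond; apply: eq_bigr => k _; rewrite !mxE /G.
  case: ifP => xik; last by rewrite mul0r if_same.
  case: ifP => xkj; last by rewrite mulr0.
  have mE : m = ((x k %/ x i) * (x j %/ x k))%N by rewrite mulnC muln_divA ?divnK.
  rewrite -mulrA; congr (_ * _); rewrite mE gM // divn_gt0 //.
    exact: dvdn_leq.
  exact: dvdn_leq.
rewrite sum_factor_closed // => [|d]; last exact/x_fc/codom_f.
(* Only multiples of [x i] contribute, and those dividing [x j] are [x i * e] with [e] dividing
   [m]. *)
have -> : \sum_(d <- divisors (x j)) G d =
    \sum_(d <- [seq (x i * e)%N | e <- divisors m]) G d.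
  rewrite (bigID (dvdn (x i))) /= [X in _ + X]big1 => [|d /negPf xid]; last first.
    by rewrite /G xid.
  rewrite addr0 -big_filter; apply: perm_big; apply: uniq_perm => [||d].
  - by rewrite filter_uniq ?divisors_uniq.
  - rewrite map_inj_uniq ?divisors_uniq // => u v /eqP.
    by rewrite eqn_pmul2l // => /eqP.
  rewrite mem_filter -dvdn_divisors // xjE.
  apply/andP/mapP => [[/dvdnP[e ->]]|[e em ->]].
    by rewrite mulnC dvdn_pmul2l // dvdn_divisors // => em; exists e.
  by rewrite dvdn_mulr // dvdn_pmul2l // dvdn_divisors.
rewrite big_map; under eq_bigr => e _ do rewrite /G dvdn_mulr // mulKn //.
rewrite -mulr_suml sum_mobius //.
have -> : (m == 1%N) = (i == j).
  apply/eqP/eqP => [m1|ij]; first by apply: x_inj; rewrite xjE m1 muln1.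
  by rewrite /m ij divnn x_gt0.
by case: eqP => [ij|_]; rewrite ?mul0r // /m ij divnn x_gt0 g1 mulr1.
Qed.

(** An index [k] contributes to entry (i, j) exactly when [x k] divides both [x i] and [x j], that
    is, their gcd. *)
Lemma zeta_mx_congr (g H : nat -> C) : completely_multiplicative_arith g ->
  (zeta_mx g)^T *m diag_mx (\row_j H (x j)) *m zeta_mx g =
  \matrix_(i, j) \sum_(d <- divisors (gcdn (x i) (x j)))
                    H d * (g (x i %/ d)%N * g (x j %/ d)%N).
Proof.
move=> g_cm; apply/matrixP => i j; rewrite !mxE.
have gcd_gt0 : (0 < gcdn (x i) (x j))%N by rewrite gcdn_gt0 x_gt0.
rewrite -(sum_factor_closed (fun d => H d * (g (x i %/ d)%N * g (x j %/ d)%N)))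
  // => [|d]; last first.
  by rewrite dvdn_gcd => /andP[di _]; apply: x_fc di; apply: codom_f.
rewrite [RHS]big_mkcond; apply: eq_bigr => k _.
rewrite mul_mx_diag !mxE dvdn_gcd.
by case: ifP; case: ifP => _ _ /=; rewrite ?mul0r ?mulr0 // mulrAC mulrC.
Qed.

Lemma twisted_mobius_diag (g H : nat -> C) M : completely_multiplicative_arith g ->
    M = (zeta_mx g)^T *m diag_mx (\row_j H (x j)) *m zeta_mx g ->
  (twisted_mobius_mx x g)^T *m M *m twisted_mobius_mx x g =
  diag_mx (\row_j H (x j)).
Proof.
move=> g_cm ->; rewrite !mulmxA -trmx_mul -mulmxA.
by rewrite twisted_mobius_mxK // trmx1 mul1mx mulmx1.
Qed.

(** The plain Moebius matrix is the twist by the constant 1, for which the congruence entries reduce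
    to [sum_gcd_factor]. *)
Lemma gcd_mx_mobius_diag (g : nat -> C) : multiplicative_arith g ->
  (mobius_mx C x)^T *m gcd_mx x g *m mobius_mx C x =
  diag_mx (\row_j gcd_factor g (x j)).
Proof.
have one_cm : completely_multiplicative_arith (fun=> 1 : C).
  by split=> // *; rewrite mulr1.
have -> : mobius_mx C x = twisted_mobius_mx x (fun=> 1).
  by apply/matrixP => i j; rewrite !mxE mulr1.
move=> g_mult; apply: twisted_mobius_diag => //; rewrite zeta_mx_congr //.
apply/matrixP => i j; rewrite !mxE -sum_gcd_factor ?gcdn_gt0 ?x_gt0 //.
by apply: eq_bigr => d _; rewrite !mulr1.
Qed.

Lemma lcm_mx_mobius_diag (g : nat -> C) : completely_multiplicative_arith g ->
  (twisted_mobius_mx x g)^T *m lcm_mx x g *m twisted_mobius_mx x g =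
  diag_mx (\row_j lcm_factor g (x j)).
Proof.
move=> g_cm; apply: twisted_mobius_diag => //; rewrite zeta_mx_congr //.
apply/matrixP => i j; rewrite !mxE.
set u := x i; set v := x j; set c := gcdn u v.
have [u_gt0 v_gt0] : (0 < u)%N /\ (0 < v)%N by split; apply: x_gt0.
have c_gt0 : (0 < c)%N by rewrite gcdn_gt0 u_gt0.
have [cu cv] : (c %| u)%N /\ (c %| v)%N by rewrite dvdn_gcdl dvdn_gcdr.
have [uc_gt0 vc_gt0] : (0 < u %/ c)%N /\ (0 < v %/ c)%N.
  by split; rewrite divn_gt0 // dvdn_leq.
rewrite lcmn_gcdnE -/c.
rewrite g_cm.2 ?muln_gt0 ?uc_gt0 // -(sum_lcm_factor g_cm c_gt0) mulr_suml.
rewrite !big_seq; apply: eq_bigr => d; rewrite -dvdn_divisors // => dc.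
have cd_gt0 : (0 < c %/ d)%N.
  by rewrite divn_gt0 ?(dvdn_gt0 c_gt0 dc) // dvdn_leq.
(* Since w/d = (c/d)(w/c), applying this to [u] and [v] produces the square [g (c %/ d) ^+ 2] of
   [sum_lcm_factor]. *)
have gdiv w : (c %| w)%N -> (0 < w %/ c)%N ->
    g (w %/ d)%N = g (c %/ d)%N * g (w %/ c)%N.
  by move=> cw wc_gt0; rewrite -g_cm.2 // mulnC muln_divA // divnK.
by rewrite (gdiv u) // (gdiv v) // g_cm.2 //; ring.
Qed.

(** Absorbs the literal 1 at index 0: for Euler products [F 1] is an empty product. *)
Lemma diag1_mxE (n_gt0 : (0 < n)%N) (F : nat -> C) :
  x (Ordinal n_gt0) = 1%N -> F 1%N = 1 ->
  diag1_mx x F = diag_mx (\row_j F (x j)).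
Proof.
move=> x_1 F1; congr diag_mx; apply/rowP => j; rewrite !mxE.
case: eqP => // j0; have -> : j = Ordinal n_gt0 by apply: val_inj.
by rewrite x_1 F1.
Qed.

End FactorClosed.

(** * Specialization to the powers of [f] over the complex numbers *)

Theorem corollary3p3 (R : realType) (a n : nat)
    (a_gt0 : (0 < a)%N) (n_gt0 : (0 < n)%N)
    (x : 'I_n -> nat)
    (x_gt0 : forall i : 'I_n, (0 < x i)%N)
    (x_inj : injective x)
    (x_fc : factor_closed (codom x))
    (x_1 : x (Ordinal n_gt0) = 1%N)
    (f : nat -> R[i]) :
  let fa := fun m : nat => f m ^+ a in
  let B : 'M[R[i]]_n := mobius_mx R[i] x in
  let B_fa : 'M[R[i]]_n := twisted_mobius_mx x fa in
  (multiplicative_arith f ->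
     B^T *m gcd_mx x fa *m B =
       diag1_mx x (fun m => \prod_(p <- primes m)
         (fa (p ^ logn p m)%N - fa (p ^ (logn p m - 1))%N)))
  /\
  (completely_multiplicative_arith f ->
     B^T *m gcd_mx x fa *m B =
       diag1_mx x (fun m => \prod_(p <- primes m)
         (f p ^+ (a * logn p m) - f p ^+ (a * (logn p m - 1))))
     /\
     B_fa^T *m lcm_mx x fa *m B_fa =
       diag1_mx x (fun m => \prod_(p <- primes m)
         (f p ^+ (a * logn p m) - f p ^+ (a * (logn p m + 1))))).
Proof.
move=> fa B B_fa; split=> [f_mult|f_cm].
  rewrite /B (gcd_mx_mobius_diag _ x_inj) //; last exact: multiplicative_exp.
  by rewrite (diag1_mxE x_1) ?big_nil.
have fa_cm : completely_multiplicative_arith fa.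
  exact: completely_multiplicative_exp.
have f_mult := completely_multiplicative_multiplicative f_cm.
split.
  rewrite /B (gcd_mx_mobius_diag _ x_inj) //; last exact: multiplicative_exp.
  rewrite (diag1_mxE x_1) ?big_nil //; congr diag_mx; apply/rowP => j.
  rewrite !mxE; apply: eq_big_seq => p; rewrite mem_primes => /andP[p_pr _].
  (* Here [fa (p ^ v) = fa p ^+ v = f p ^+ (a * v)]. *)
  by rewrite !(completely_multiplicativeX _ (prime_gt0 p_pr) fa_cm) /fa -!exprM.
rewrite /B_fa lcm_mx_mobius_diag // (diag1_mxE x_1) ?big_nil //.
congr diag_mx; apply/rowP => j; rewrite !mxE.
by apply: eq_bigr => p _; rewrite -!exprM.
Qed.
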